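(* Let $(X,\mathcal U)$ be a sequentially right $K$-complete quasi-uniform space whose quasi-uniformity is generated by an $F$-quasi-gauge $D$ (i.e. $\mathcal U=\mathcal U_D$), and suppose that the topology $\tau(\mathcal U)$ is $T_1$. Let $F:X\times X\to\mathbb R\cup\{\infty\}$ and $x_0\in X$ satisfy: (E1) $F(x,x)=0$ for all $x\in X$; (E2) $F(x,z)\le F(x,y)+F(y,z)$ for all $x,y,z\in X$; (E3) for every $x\in X$ the function $F(x,\cdot)$ is sequentially $\mathcal U$-lsc; (E4) $\inf\{F(x_0,y):y\in X\}>-\infty$. Then there exists $z\in X$ with $F(x_0,z)+d(z,x_0)\le 0$ for all $d\in D$, such that for every $x\in X\setminus\{z\}$ there exists $d_x\in D$ with $F(z,x)+d_x(x,z)>0$.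
   Context: A quasi-uniformity on a set $X$ is a nonempty family $\mathcal U$ of subsets of $X\times X$ which contain the diagonal, closed under supersets and finite intersections, such that for every $U\in\mathcal U$ there is $V\in\mathcal U$ with $V\circ V\subseteq U$, where $M\circ N=\{(x,z):\exists y,\ (x,y)\in M,\ (y,z)\in N\}$. The topology $\tau(\mathcal U)$ has $\{U(x):U\in\mathcal U\}$, $U(x)=\{y\in X:(x,y)\in U\}$, as neighborhood basis at $x$. An $F$-quasi-gauge on $X$ is a family $D$ of functions $d:X\times X\to\mathbb R$ such that: (QF1) $D$ is directed upward (for the pointwise order); (QF2) $d(x,y)\ge 0$ and $d(x,x)=0$ for all $d\in D$, $x,y\in X$; (QF3) for every $d\in D$ there is $d'\in D$ with $d'\ge d$ such that $d(x,y)\le d'(x,z)+d'(z,y)$ for all $x,y,z\in X$. It generates the quasi-uniformity $\mathcal U_D$ having as basis the sets $V_{d,\varepsilon}=\{(x,y)\in X\times X: d(x,y)<\varepsilon\}$, $d\in D$, $\varepsilon>0$. A sequence $(x_n)$ is right $K$-Cauchy if for every $U\in\mathcal U$ there is $n_U\in\mathbb N$ such that $(x_{n+k},x_n)\in U$ for all $n\ge n_U$ and all $k\in\mathbb N$. $(X,\mathcal U)$ is sequentially right $K$-complete if every right $K$-Cauchy sequence is $\tau(\mathcal U)$-convergent to some point of $X$. A function $g:X\to\mathbb R\cup\{\infty\}$ is sequentially $\mathcal U$-lsc if $g(x)\le\liminf_n g(x_n)$ whenever $(x_n)$ is a sequence $\tau(\mathcal U)$-convergent to $x$. *)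

(* Defs.v *)
From HB Require Import structures.
From mathcomp Require Import all_boot all_order all_algebra.
From mathcomp Require Import all_classical all_reals all_analysis.

Set Implicit Arguments.
Unset Strict Implicit.
Unset Printing Implicit Defensive.

Import Order.TTheory GRing.Theory Num.Theory.
Local Open Scope classical_set_scope.
Local Open Scope ring_scope.
Local Open Scope relation_scope.

(* The interface uniformType without the symmetry axiom. [nbhs_ qentourage x]
   is generated by the sections U(x) = {y | (x, y) \in U}, so the underlying
   topologicalType carries tau(U). *)
HB.mixin Record Nbhs_isQuasiUniform_mixin M & Nbhs M := {
  qentourage : set_system (M * M);
  qentourage_filter : Filter qentourage;
  qentourage_diagonal : forall A, qentourage A -> diagonal `<=` A;
  qentourage_split_ex :
    forall A, qentourage A -> exists2 B, qentourage B & B \; B `<=` A;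
  nbhs_qentourageE : nbhs = nbhs_ qentourage;
}.

#[short(type="quasiUniformType")]
HB.structure Definition QuasiUniform :=
  {T of Topological T & Nbhs_isQuasiUniform_mixin T}.

(* Every quasi-uniformity on a choiceType gives a quasiUniformType. *)
HB.factory Record isQuasiUniform M & Choice M := {
  qentourage : set_system (M * M);
  qentourage_filter : Filter qentourage;
  qentourage_diagonal : forall A, qentourage A -> diagonal `<=` A;
  qentourage_split_ex :
    forall A, qentourage A -> exists2 B, qentourage B & B \; B `<=` A;
}.

HB.builders Context M & isQuasiUniform M.

HB.instance Definition _ := hasNbhs.Build M (nbhs_ qentourage).

Let nbhs_pfilter (p : M) : ProperFilter (nbhs p).
Proof.
apply: (@filter_from_proper _ _ qentourage (fun A => xsection A p)).
  apply: filter_from_filter.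
    by exists setT; exact: (@filterT _ _ qentourage_filter).
  move=> A B entA entB; exists (A `&` B); last by rewrite xsectionI.
  exact: (@filterI _ _ qentourage_filter).
by move=> A entA; exists p; apply/mem_set; apply: qentourage_diagonal entA _ _.
Qed.

Let nbhs_singleton (p : M) A : nbhs p A -> A p.
Proof.
move=> -[B entB sBpA].
by apply/sBpA/mem_set; exact: qentourage_diagonal entB _ _.
Qed.

Let nbhs_nbhs (p : M) A : nbhs p A -> nbhs p (nbhs^~ A).
Proof.
move=> -[B entB sBpA].
have [C entC sC2B] := qentourage_split_ex entB.
exists C => // q Cpq; exists C => // r Cqr.
by apply/sBpA/mem_set/sC2B; exists q; exact/set_mem.
Qed.

HB.instance Definition _ := Nbhs_isNbhsTopological.Build M
  nbhs_pfilter nbhs_singleton nbhs_nbhs.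

HB.instance Definition _ := Nbhs_isQuasiUniform_mixin.Build M
  qentourage_filter qentourage_diagonal qentourage_split_ex erefl.

HB.end.

Local Close Scope relation_scope.

Section quasi_gauge.
Context {R : realType} {X : Type}.
Implicit Types (d : X -> X -> R) (D : set (X -> X -> R)).

(* D = set0 is not excluded here, but it generates no quasi-uniformity, as
   [gauge_entourage set0] is empty. *)
Record F_quasi_gauge D : Prop := FQuasiGauge {
  fqg_directed : forall d1 d2, D d1 -> D d2 -> exists d3, [/\ D d3,
    (forall x y, d1 x y <= d3 x y) & (forall x y, d2 x y <= d3 x y)];
  fqg_ge0 : forall d, D d -> forall x y, 0 <= d x y;
  fqg_xx : forall d, D d -> forall x, d x x = 0;
  fqg_triangle : forall d, D d -> exists d', [/\ D d',
    (forall x y, d x y <= d' x y) &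
    (forall x y z, d x y <= d' x z + d' z y)]
}.

Definition gauge_entourage D : set_system (X * X) :=
  filter_from [set de : (X -> X -> R) * R | D de.1 /\ 0 < de.2]
    (fun de => [set xy | de.1 xy.1 xy.2 < de.2]).

End quasi_gauge.

Section quasi_uniform_notions.
Context {X : quasiUniformType}.

Definition right_K_cauchy (u : nat -> X) :=
  forall U, qentourage U ->
    exists N : nat, forall n k : nat, (N <= n)%N -> U (u (n + k)%N, u n).

Definition seq_lsc {R : realType} (g : X -> \bar R) :=
  forall (u : nat -> X) (x : X), u @ \oo --> x ->
    (g x <= limn_einf (g \o u))%E.

End quasi_uniform_notions.

Definition seq_right_K_complete (X : quasiUniformType) :=
  forall u : nat -> X, right_K_cauchy u -> exists x : X, u @ \oo --> x.

(* Main.v *)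
Require Import Defs.
From mathcomp Require Import all_boot all_order all_algebra.
From mathcomp Require Import all_classical all_reals all_analysis.
From mathcomp Require Import lra.

(** Write [y <= x] when [F x y + d y x <= 0] for every [d] in the gauge. The
    triangle inequalities for [F] and for the gauge make this a preorder, and
    the theorem asserts that below [x0] there is a minimal element [z]
    satisfying the strong form of minimality: no point other than [z] is below
    [z].

    The gauge may be uncountable, so the quasi-uniformity need not have a
    countable base, and a sequence cannot be built by treating the gauge
    functions one after the other. The point is that [F] controls all of them
    simultaneously: if [y <= x] then [d y x <= - F x y] for every [d]. Choose
    [u (n + 1)] below [u n] so that [F x0] is within [1 / (n + 1)] of its
    infimum over the points below [u n]. Since [F x0] decreases along the
    preorder, it varies by at most [1 / (n + 1)] below [u (n + 1)], hence
    [d v w <= 1 / (n + 1)] uniformly in [d] whenever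
    [v <= w <= u (n + 1)] ([exists_small_section]).

    Taking [w = u m] and [v = u (m + k)] shows that [u] is right K-Cauchy.
    Lower semicontinuity of [F (u n)] shows that a limit [z] lies below every
    [u n] ([limit_below]). Finally, if [x] is below [z], then taking [v = x] and
    [w = z] for every [n] gives [d x z = 0] for all [d], and the T1 axiom forces [x = z]
    ([gauge_separated]). *)

Set Implicit Arguments.
Unset Strict Implicit.
Unset Printing Implicit Defensive.

Import Order.TTheory GRing.Theory Num.Theory.
Local Open Scope classical_set_scope.
Local Open Scope ereal_scope.

(** * Lower limits of sequences *)

Lemma limn_einf_le_frequently (R : realType) (v : nat -> \bar R) (c : \bar R) :
  (forall n, exists2 m, (n <= m)%N & v m <= c) -> limn_einf v <= c.
Proof.
move=> vc; rewrite limn_einf_lim; apply: lime_le; first exact: is_cvg_einfs.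
apply: nearW => n; have [m nm vmc] := vc n.
by apply: le_trans vmc; apply: ereal_inf_lbound; exists m.
Qed.

(** * Topology of the quasi-uniformity of a gauge *)

(** An empty gauge generates an empty family of entourages, which is not a
    filter. *)
Lemma gauge_nonempty (R : realType) (X : quasiUniformType)
    (D : set (X -> X -> R)) :
  @qentourage X = gauge_entourage D -> exists d, D d.
Proof.
move=> D_gen; have := @filterT _ _ (@qentourage_filter X).
by rewrite D_gen => -[[d e] [Dd _] _]; exists d.
Qed.

Lemma gauge_cvg (R : realType) (X : quasiUniformType)
    (D : set (X -> X -> R)) (u : nat -> X) (z : X) (d : X -> X -> R) (e : R) :
  @qentourage X = gauge_entourage D -> u @ \oo --> z -> D d -> (0 < e)%R ->
  \forall m \near \oo, (d z (u m) < e)%R.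
Proof.
move=> D_gen uz Dd e0; apply: (uz [set y | (d z y < e)%R]).
rewrite nbhs_qentourageE; exists [set xy | (d xy.1 xy.2 < e)%R].
  by rewrite D_gen; exists (d, e).
by move=> y /set_mem.
Qed.

(** The hypothesis puts [y] in every neighbourhood of [x]. *)
Lemma gauge_separated (R : realType) (X : quasiUniformType)
    (D : set (X -> X -> R)) (x y : X) :
  @qentourage X = gauge_entourage D -> accessible_space X ->
  (forall d, D d -> d x y <= 0)%R -> x = y.
Proof.
move=> D_gen X_T1 dxy; apply/eqP/negPn/negP => /X_T1[A [Aopen /set_mem Ax]].
move=> /set_mem; apply.
have : nbhs x A by exact: open_nbhs_nbhs.
rewrite nbhs_qentourageE D_gen => -[U [[d e] [/= Dd e0] dU] UA].
apply: UA; apply/mem_set; apply: dU => /=.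
exact: le_lt_trans (dxy _ Dd) e0.
Qed.

(** * The preorder defined by a bifunction and a gauge *)

Definition below (R : realType) (X : Type) (D : set (X -> X -> R))
    (F : X -> X -> \bar R) (x : X) : set X :=
  [set y | forall d, D d -> F x y + (d y x)%:E <= 0].

Lemma below_refl (R : realType) (X : Type) (D : set (X -> X -> R))
    (F : X -> X -> \bar R) (x : X) :
  F_quasi_gauge D -> F x x = 0 -> below D F x x.
Proof. by move=> D_gauge Fxx d Dd; rewrite Fxx (fqg_xx D_gauge Dd) adde0. Qed.

(** [+oo + r <= 0] fails for real [r], so [F x y] is finite as soon as one gauge
    function testifies to it. *)
Lemma below_fin_num (R : realType) (X : Type) (D : set (X -> X -> R))
    (F : X -> X -> \bar R) (x y : X) :
  (exists d, D d) -> F x y != -oo -> below D F x y -> F x y \is a fin_num.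
Proof. by move=> [d Dd] FNy /(_ d Dd); move: FNy; case: (F x y). Qed.

Lemma below_trans (R : realType) (X : Type) (D : set (X -> X -> R))
    (F : X -> X -> \bar R) (x y z : X) :
  F_quasi_gauge D -> (forall x y, F x y != -oo) ->
  (forall x y z, F x z <= F x y + F y z) ->
  below D F x y -> below D F y z -> below D F x z.
Proof.
move=> D_gauge FNy F_tri xy yz d Dd.
have [d' [Dd' _ d_tri]] := fqg_triangle D_gauge Dd.
have D0 : exists d, D d by exists d.
have := F_tri x y z; have := xy _ Dd'; have := yz _ Dd'; have := d_tri z x y.
have := FNy x z.
rewrite -(fineK (below_fin_num D0 (FNy _ _) xy)).
rewrite -(fineK (below_fin_num D0 (FNy _ _) yz)).
case: (F x z) => // r _; rewrite -!EFinD !lee_fin; lra.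
Qed.

(** A near-minimizer [y] of [F x0] over the points below [x]: along
    [v <= w <= y] the function [F x0] drops by at least [d v w] from [w] to [v],
    does not increase from [y] to [w], and in total it drops by at most [e]. *)
Lemma exists_small_section (R : realType) (X : Type) (D : set (X -> X -> R))
    (F : X -> X -> \bar R) (x0 x : X) (e : R) :
  F_quasi_gauge D -> (exists d, D d) -> (forall x y, F x y != -oo) ->
  (forall x, F x x = 0) -> (forall x y z, F x z <= F x y + F y z) ->
  -oo < ereal_inf [set F x0 y | y in [set: X]] ->
  below D F x0 x -> (0 < e)%R ->
  exists2 y, below D F x y & forall w v, below D F y w -> below D F w v ->
    forall d, D d -> (d v w <= e)%R.
Proof.
move=> D_gauge D0 FNy Fxx F_tri F_bd x0x e0.
have trans a b c := @below_trans R X D F a b c D_gauge FNy F_tri.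
have fin a b := @below_fin_num R X D F a b D0 (FNy a b).
pose I := ereal_inf (F x0 @` below D F x).
have I_fin : I \is a fin_num.
  rewrite fin_numE; apply/andP; split.
    rewrite -ltNye; apply: lt_le_trans F_bd _.
    by apply: ereal_inf_le_tmp => _ [y _ <-]; exists y.
  rewrite -ltey; apply: (@le_lt_trans _ _ (F x0 x)).
    by apply: ereal_inf_lbound; exists x => //; exact: below_refl.
  by rewrite ltey_eq fin.
have [_ [y xy <-] yI] := lb_ereal_inf_adherent e0 I_fin.
exists y => // w v yw wv d Dd.
have Iv : I <= F x0 v.
  by apply: ereal_inf_lbound; exists v => //; exact: (trans _ _ _ (trans _ _ _ xy yw) wv).
have x0y := trans _ _ _ x0x xy; have x0w := trans _ _ _ x0y yw.
have x0v := trans _ _ _ x0w wv.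
have dw := fqg_ge0 D_gauge Dd w y.
have := F_tri x0 y w; have := F_tri x0 w v; have := yw _ Dd; have := wv _ Dd.
move: yI Iv; rewrite -/I -(fineK I_fin).
rewrite -(fineK (fin _ _ x0y)) -(fineK (fin _ _ x0w)) -(fineK (fin _ _ x0v)).
rewrite -(fineK (fin _ _ yw)) -(fineK (fin _ _ wv)).
rewrite -!EFinD !lee_fin lte_fin; lra.
Qed.

Lemma exists_small_sequence (R : realType) (X : Type) (D : set (X -> X -> R))
    (F : X -> X -> \bar R) (x0 : X) :
  F_quasi_gauge D -> (exists d, D d) -> (forall x y, F x y != -oo) ->
  (forall x, F x x = 0) -> (forall x y z, F x z <= F x y + F y z) ->
  -oo < ereal_inf [set F x0 y | y in [set: X]] ->
  exists u : nat -> X, [/\ u 0%N = x0,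
    (forall n k, below D F (u n) (u (n + k)%N)) &
    (forall n w v, below D F (u n.+1) w -> below D F w v ->
       forall d, D d -> (d v w <= n.+1%:R^-1)%R)].
Proof.
move=> D_gauge D0 FNy Fxx F_tri F_bd.
have /choice[g gP] (p : nat * X) : exists y, below D F x0 p.2 ->
    below D F p.2 y /\ forall w v, below D F y w -> below D F w v ->
      forall d, D d -> (d v w <= p.1.+1%:R^-1)%R.
  have [x0p|nx0p] := pselect (below D F x0 p.2); last by exists x0.
  have e0 : (0 < p.1.+1%:R^-1 :> R)%R by rewrite invr_gt0 ltr0n.
  have [y py small] :=
    exists_small_section D_gauge D0 FNy Fxx F_tri F_bd x0p e0.
  by exists y => _; split.
pose u := fix u n := if n is m.+1 then g (m, u m) else x0.
have x0u n : below D F x0 (u n).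
  elim: n => [|n IHn]; first exact: below_refl.
  exact: (below_trans D_gauge FNy F_tri IHn (gP (n, u n) IHn).1).
exists u; split=> // [n k|n]; last exact: (gP (n, u n) (x0u n)).2.
elim: k => [|k IHk]; first by rewrite addn0; exact: below_refl.
rewrite addnS; apply: (below_trans D_gauge FNy F_tri IHk).
exact: (gP ((n + k)%N, u (n + k)%N) (x0u _)).1.
Qed.

(** Once [d'] satisfies the triangle inequality for [d], being below [x] gives
    [F x (u m) <= - d' (u m) x <= d' z (u m) - d z x], whose first term tends
    to 0; lower semicontinuity passes this to [F x z]. *)
Lemma limit_below (R : realType) (X : quasiUniformType)
    (D : set (X -> X -> R)) (F : X -> X -> \bar R) (x z : X) (u : nat -> X) :
  F_quasi_gauge D -> @qentourage X = gauge_entourage D -> seq_lsc (F x) ->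
  (\forall m \near \oo, below D F x (u m)) -> u @ \oo --> z -> below D F x z.
Proof.
move=> D_gauge D_gen F_lsc xu uz d Dd.
have [d' [Dd' _ d_tri]] := fqg_triangle D_gauge Dd.
suff Fxz : F x z <= (- d z x)%:E.
  by rewrite -leeBrDr // add0e.
apply/lee_addgt0Pr => e e0; apply: le_trans (F_lsc _ _ uz) _.
apply: limn_einf_le_frequently => n.
have [N _ NP] := filterI xu (gauge_cvg D_gen uz Dd' e0).
exists (maxn n N); first exact: leq_maxl.
have [/(_ d' Dd') xum zum] := NP _ (leq_maxr n N).
move: xum zum => /=; have := d_tri z x (u (maxn n N)).
case: (F x _) => [r| |] //; rewrite -?EFinD ?lee_fin; first lra.
by move=> *; exact: leNye.
Qed.

(** * Ekeland principle for bifunctions *)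

Theorem corollary4p18 (R : realType) (X : quasiUniformType)
    (D : set (X -> X -> R)) (F : X -> X -> \bar R) (x0 : X)
    (X_complete : seq_right_K_complete X)
    (D_gauge : F_quasi_gauge D)
    (D_gen : @qentourage X = gauge_entourage D)
    (X_T1 : accessible_space X)
    (F_neqNy : forall x y, F x y != -oo)
    (E1 : forall x, F x x = 0)
    (E2 : forall x y z, F x z <= F x y + F y z)
    (E3 : forall x, seq_lsc (F x))
    (E4 : -oo < ereal_inf [set F x0 y | y in [set: X]]) :
  exists z : X,
    (forall d, D d -> F x0 z + (d z x0)%:E <= 0) /\
    (forall x, x != z -> exists2 d_x, D d_x & 0 < F z x + (d_x x z)%:E).
Proof.
have D0 := gauge_nonempty D_gen.
have [u [u0 u_desc u_small]] :=
  exists_small_sequence D_gauge D0 F_neqNy E1 E2 E4.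
have inv_small (e : R) : (0 < e)%R -> exists N, forall n, (N <= n)%N ->
    (n.+1%:R^-1 < e)%R.
  by move=> e0; have [N _ NP] := near_infty_natSinv_lt (PosNum e0); exists N.
have u_cauchy : right_K_cauchy u.
  move=> U; rewrite D_gen => -[[d e] [/= Dd e0] dU].
  have [N NP] := inv_small _ e0.
  (* the bound below [u n.+1] has index [n], and [u 0] has none *)
  exists N.+1 => -[//|n] k Nn; apply: dU => /=.
  apply: le_lt_trans (NP _ Nn).
  by apply: (u_small n) => //; exact: below_refl.
have [z uz] := X_complete _ u_cauchy.
have u_z n : below D F (u n) z.
  apply: (limit_below D_gauge D_gen (E3 _) _ uz).
  by exists n => // m /= nm; rewrite -(subnKC nm); exact: u_desc.
exists z; split; first by rewrite -u0; exact: u_z.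
move=> x xz; apply/not_exists2P => x_below; move/eqP: xz; apply.
have {}x_below : below D F z x.
  by move=> d Dd; have [//|/negP] := x_below d; rewrite -leNgt.
apply: (gauge_separated D_gen X_T1) => d Dd.
apply/ler_addgt0Pr => e e0; rewrite add0r; have [N NP] := inv_small _ e0.
exact: le_trans (u_small N z x (u_z _) x_below d Dd) (ltW (NP N (leqnn N))).
Qed.
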